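(* For every integer $k\ge 2$ there is a constant $C=C(k)>0$, and for every $\epsilon\in(0,1)$ and every integer $k\geq 2$ there is $n_5=n_5(k,\epsilon)$, such that the following holds. Suppose that $G$ is a finite abelian group of order at least $n_5$, and that $A\subseteq G$ is $k$-stable. Then there is a subgroup $H\leq G$ of index at most $\exp(\epsilon^{-C})$ and a set $J\subseteq G/H$ of cosets of $H$ such that $$\Big|A\,\Delta \bigcup_{H+g\in J} (H+g)\Big|\leq \epsilon |G|.$$
   Context: Stability: for a group $G$ (written additively), $A\subseteq G$ and an integer $k\geq 2$, the set $A$ has the $k$-order property if there exist $a_1,\dots,a_k,b_1,\dots,b_k\in G$ such that $a_i+b_j\in A$ if and only if $i\leq j$. The set $A$ is $k$-stable if it does not have the $k$-order property. $\Delta$ denotes symmetric difference of sets. *)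

(* Defs.v *)
(* Groups are written multiplicatively, as in fingroup: the sum a_i + b_j is
   (a i * b j)%g and the coset H + g is H :* g. *)
From mathcomp Require Import all_boot all_fingroup.

Set Implicit Arguments.
Unset Strict Implicit.
Unset Printing Implicit Defensive.

(* The a_i, b_j range over G, not over the whole ambient type gT; they need not
   be distinct.  Indices run over 0, ..., k - 1 instead of 1, ..., k. *)
Definition order_property (gT : finGroupType) (G : {group gT}) (k : nat)
    (A : {set gT}) : Prop :=
  exists a b : 'I_k -> gT,
    [/\ forall i, a i \in G,
        forall j, b j \in G
      & forall i j, (a i * b j)%g \in A <-> (i <= j)%N].

Definition stable (gT : finGroupType) (G : {group gT}) (k : nat)
    (A : {set gT}) : Prop :=
  ~ order_property G k A.

Definition symdiff (T : finType) (A B : {set T}) : {set T} :=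
  (A :\: B) :|: (B :\: A).

(* Main.v *)
Require Import Defs.
From mathcomp Require Import all_boot all_order all_algebra all_fingroup.
From mathcomp Require Import reals sequences exp.
From mathcomp Require Import zify lra.

Set Implicit Arguments.
Unset Strict Implicit.
Unset Printing Implicit Defensive.

Import Order.TTheory GRing.Theory Num.Theory.

(* Read the group as the bipartite relation g + x in A.  Stability forbids tall
   trees, so repeatedly splitting G by translates of A must stop, at a set X of
   density at least m^-d such that every row {x in X : g + x in A} has relative
   density at most 1/m or at least 1 - 1/m.  Let B be the set of g whose row is
   a majority.  Averaging over x in X gives an x for which A differs from B + x
   in at most |G|/m points, and B + x is a union of cosets of the stabiliser H
   of B.  If two translates B - y, B - y' differ, then A - y and A - y' differ in
   at least |X|/2 points; but for a second such set X', with m replaced by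
   8 m^d, most pairs y, y' in X' violate this.  Hence most pairs of X' lie in a
   common coset of H, so |X'| <= 2|H|, and the index of H is even polynomial in
   1/epsilon. *)

(** * Binary trees and half-graphs *)

Lemma subset_sep (T : finType) (X : {set T}) (p : pred T) :
  [set x in X | p x] \subset X.
Proof. by apply/subsetP=> x; rewrite inE => /andP[]. Qed.

(** Nodes of one level may carry different labels, so a tree of height [d] means Littlestone
    dimension (Shelah's 2-rank) at least [d]. *)
Fixpoint tree (S T : finType) (r : S -> T -> bool) (d : nat)
    (Y : {set S}) (X : {set T}) : Prop :=
  if d is d'.+1 then
    exists2 g, g \in Y &
      tree r d' Y [set x in X | r g x] /\ tree r d' Y [set x in X | ~~ r g x]
  else exists x, x \in X.

Lemma tree_subset (S T : finType) (r : S -> T -> bool) d (Y Y' : {set S})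
    (X X' : {set T}) :
  Y \subset Y' -> X \subset X' -> tree r d Y X -> tree r d Y' X'.
Proof.
move=> sY; elim: d X X' => [|d IH] X X' sX /=.
  by case=> x xX; exists x; apply: (subsetP sX).
case=> g gY [t1 t0]; exists g; first exact: (subsetP sY).
by split; [apply: IH t1 | apply: IH t0];
  apply/subsetP=> x; rewrite !inE => /andP[/(subsetP sX) -> ->].
Qed.

Lemma tree_neq0 (S T : finType) (r : S -> T -> bool) d (Y : {set S})
    (X : {set T}) :
  tree r d Y X -> exists x, x \in X.
Proof.
elim: d X => //= d IH X [g _ [/IH[x]]]; rewrite inE => /andP[xX _] _.
by exists x.
Qed.

(** Ramsey property of trees. If the root is in [Y1], lower [n] by one and use induction in both
    halves: either both contain the shorter [Y1]-tree and the root joins them, or one half already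
    holds the full [Y2]-tree. The case of [Y2] is symmetric. *)
Lemma tree_setU (S T : finType) (r : S -> T -> bool) n m (Y1 Y2 : {set S})
    (X : {set T}) :
  tree r (n + m) (Y1 :|: Y2) X -> tree r n Y1 X \/ tree r m Y2 X.
Proof.
elim: n m X => [|n IHn] m X; first by move/tree_neq0; left.
elim: m X => [|m IHm] X; first by move/tree_neq0; right.
rewrite addnS; case=> g; rewrite inE => /orP[gY | gY].
  rewrite addSnnS => -[/IHn[t1|t1] /IHn[t0|t0]];
    by [left; exists g
       | right; apply: tree_subset (subxx _) (subset_sep _ _) t1
       | right; apply: tree_subset (subxx _) (subset_sep _ _) t0].
by move=> [/IHm[t1|t1] /IHm[t0|t0]];
    by [right; exists g
       | left; apply: tree_subset (subxx _) (subset_sep _ _) t1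
       | left; apply: tree_subset (subxx _) (subset_sep _ _) t0].
Qed.

(* h(0) = 0 and h(k + 1) = 2 h(k) + 2. *)
Definition order_height (k : nat) := 2 ^ k.+1 - 2.

(* Hodges' argument: pick the root [g] and a leaf [x] with [r g x], and colour
   the labels [y] by [r y x].  Either a tall subtree has all its labels
   unrelated to [x], and [(g, x)] is put in front, or one has them all related
   to [x], and its root together with [x] is put at the end. *)
Lemma tree_order (S T : finType) (r : S -> T -> bool) (s0 : S) (t0 : T) k
    (Y : {set S}) (X : {set T}) :
  tree r (order_height k) Y X ->
  exists (a : nat -> S) (b : nat -> T),
    [/\ forall i, i < k -> a i \in Y,
        forall j, j < k -> b j \in X
      & forall i j, i < k -> j < k -> r (a i) (b j) = (i <= j)].
Proof.
elim: k Y X => [|k IH] Y X; first by exists (fun=> s0), (fun=> t0).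
(* One level is spent on [g]; below it the two colours ask for heights h(k) and h(k) + 1, the extra
   level being the root [g']. *)
have -> : order_height k.+1 = (order_height k + (order_height k).+1).+1.
  by rewrite /order_height !expnS; have := expn_gt0 2 k; lia.
case=> g gY [t1 _]; have [x] := tree_neq0 t1; rewrite inE => /andP[xX rgx].
have eY : Y = [set y in Y | ~~ r y x] :|: [set y in Y | r y x].
  by apply/setP=> y; rewrite !inE; case: (y \in Y); case: (r y x).
move: t1; rewrite {1}eY => /tree_setU[/IH | /= [g']].
  move=> [a [b [aY bX ab]]].
  exists (fun i => if i is i'.+1 then a i' else g).
  exists (fun j => if j is j'.+1 then b j' else x).
  split=> [[|i] // /aY|[|j] // /bX|[|i] [|j] // ik jk].
  - by rewrite inE => /andP[].
  - by rewrite inE => /andP[].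
  - by have := bX j jk; rewrite inE => /andP[_ ->].
  - by have := aY i ik; rewrite inE => /andP[_ /negPf ->].
  - exact: ab.
(* The negative side of [g'] is kept, so [g'] is unrelated to every [b j], while every [a i] is
   related to [x]. *)
rewrite inE => /andP[g'Y rg'x] [_ /IH [a [b [aY bX ab]]]].
exists (fun i => if i < k then a i else g').
exists (fun j => if j < k then b j else x).
split=> [i _|j _|i j].
- by case: ifP => // /aY; rewrite inE => /andP[].
- by case: ifP => // /bX; rewrite !inE => /andP[/andP[]].
rewrite !ltnS => ik jk; case: ifP => ik'; case: ifP => jk'.
- exact: ab.
- by have := aY i ik'; rewrite inE => /andP[_ ->]; lia.
- by have := bX j jk'; rewrite !inE => /andP[_ /negPf ->]; lia.
- by rewrite rg'x; lia.
Qed.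

(** * Sets on which every row is nearly constant *)

Definition good (S T : finType) (r : S -> T -> bool) (m : nat)
    (Y : {set S}) (X : {set T}) : bool :=
  [forall g in Y, (m * #|[set x in X | r g x]| <= #|X|)
               || (m * #|[set x in X | ~~ r g x]| <= #|X|)].

Lemma card_row (T : finType) (X : {set T}) (p : pred T) :
  #|[set x in X | p x]| + #|[set x in X | ~~ p x]| = #|X|.
Proof.
rewrite -(cardsID [set x | p x] X); congr (_ + _); apply: eq_card => x;
by rewrite !inE // andbC.
Qed.

(** A set that is not good is cut by some row into two pieces, each more than 1/m of it. Recurse on
    both: two trees join at that row, and a good set inside a piece costs one factor [m]. *)
Lemma tree_or_good (S T : finType) (r : S -> T -> bool) m d (Y : {set S})
    (X : {set T}) :
  0 < m -> 0 < #|X| ->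
  tree r d Y X \/
  exists Z : {set T}, [/\ Z \subset X, good r m Y Z, 0 < #|Z|
    & #|X| <= m ^ d * #|Z|].
Proof.
move=> m0; elim: d X => [|d IH] X X0; first by left; apply/card_gt0P.
case: (boolP (good r m Y X)) => [gX|].
  by right; exists X; rewrite subxx gX X0 leq_pmull ?expn_gt0 ?m0.
case/forall_inPn => g gY; rewrite negb_or -!ltnNge => /andP[h1 h0].
have step (X' : {set T}) : X' \subset X -> #|X| < m * #|X'| ->
    tree r d Y X' \/ exists Z : {set T},
      [/\ Z \subset X, good r m Y Z, 0 < #|Z| & #|X| <= m ^ d.+1 * #|Z|].
  move=> sX' hX'; case: (IH X') => [|t|[Z [sZ gZ Z0 hZ]]]; [|by left|right].
    by case: #|X'| hX' => //; rewrite muln0.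
  exists Z; split; rewrite ?(subset_trans sZ) // expnS -mulnA (leq_trans (ltnW hX')) //.
  by rewrite leq_mul2l hZ orbT.
case: (step _ (subset_sep _ _) h1) => [t1|]; last by right.
by case: (step _ (subset_sep _ _) h0) => [t0|]; [left; exists g | right].
Qed.

Lemma card_pairsC (S T : finType) (P : S -> T -> bool) (Y : {set S})
    (X : {set T}) :
  \sum_(x in X) #|[set g in Y | P g x]| = \sum_(g in Y) #|[set x in X | P g x]|.
Proof.
have E (U : finType) (Z : {set U}) (p : pred U) :
    #|[set z in Z | p z]| = \sum_(z in Z) p z.
  by rewrite -sum1_card big_mkcond [RHS]big_mkcond; apply: eq_bigr => z _;
    rewrite inE; case: (z \in Z); case: (p z).
by under eq_bigr do rewrite E; rewrite exchange_big; apply: eq_bigr => g _; rewrite E.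
Qed.

Definition majority (S T : finType) (r : S -> T -> bool) (Y : {set S})
    (X : {set T}) : {set S} :=
  [set g in Y | #|X| <= 2 * #|[set x in X | r g x]|].

Lemma good_majority (S T : finType) (r : S -> T -> bool) m (Y : {set S})
    (X : {set T}) g :
  2 < m -> good r m Y X -> 0 < #|X| -> g \in Y ->
  m * #|[set x in X | r g x != (g \in majority r Y X)]| <= #|X|.
Proof.
move=> m2 /forall_inP gX X0 gY; have := gX g gY.
have -> : (g \in majority r Y X) = (#|X| <= 2 * #|[set x in X | r g x]|).
  by rewrite inE gY.
have := card_row X (r g); case: (leqP #|X| (2 * _)) => hm ht.
  have -> : [set x in X | r g x != true] = [set x in X | ~~ r g x].
    by apply/setP=> x; rewrite !inE eqb_id.
  by case/orP=> // h; nia.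
have -> : [set x in X | r g x != false] = [set x in X | r g x].
  by apply/setP=> x; rewrite !inE; case: (r g x).
by case/orP=> // h; nia.
Qed.

(** Sum [good_majority] over [g] and count by columns: the average column disagrees with the
    majority at most |Y|/m times. *)
Lemma majority_approx (S T : finType) (r : S -> T -> bool) m (Y : {set S})
    (X : {set T}) :
  2 < m -> good r m Y X -> 0 < #|X| ->
  exists2 x, x \in X
    & m * #|[set g in Y | r g x != (g \in majority r Y X)]| <= #|Y|.
Proof.
move=> m2 gX X0; apply/exists_inP; apply: contraT => /exists_inPn hn.
have : \sum_(x in X) m * #|[set g in Y | r g x != (g \in majority r Y X)]|
    <= #|Y| * #|X|.
  rewrite -big_distrr /= card_pairsC big_distrr /= -sum_nat_const.
  by apply: leq_sum => g gY; apply: good_majority.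
apply: contraLR => _; rewrite -ltnNge mulnC -sum_nat_const.
have [x0 x0X] := card_gt0P X0.
rewrite (bigD1 x0) //= [X in _ < X](bigD1 x0) //=.
have := hn _ x0X; rewrite -ltnNge => h0; rewrite -addSn; apply: leq_add => //.
by apply: leq_sum => x /andP[/hn xX _]; rewrite ltnW // ltnNge.
Qed.

(** The ordered pairs separated by [g] number twice the product of the two parts of its row, and one
    part is at most |X|/m. *)
Lemma good_pairs (S T : finType) (r : S -> T -> bool) m (Y : {set S})
    (X : {set T}) :
  good r m Y X ->
  m * \sum_(x in X) \sum_(y in X) #|[set g in Y | r g x != r g y]|
    <= 2 * #|X| ^ 2 * #|Y|.
Proof.
move=> /forall_inP gX.
have -> : \sum_(x in X) \sum_(y in X) #|[set g in Y | r g x != r g y]|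
  = \sum_(g in Y) 2 * (#|[set x in X | r g x]| * #|[set x in X | ~~ r g x]|).
  under eq_bigr do rewrite card_pairsC.
  rewrite exchange_big; apply: eq_bigr => g gY.
  rewrite (bigID (r g)) /= mul2n -addnn; congr (_ + _).
    rewrite -sum_nat_const; apply: eq_big => [x|x /andP[_ rx]]; first by rewrite !inE.
    by apply: eq_card => y; rewrite !inE rx; case: (r g y).
  rewrite mulnC -sum_nat_const; apply: eq_big => [x|x /andP[_ /negPf rx]]; first by rewrite !inE.
  by apply: eq_card => y; rewrite !inE rx; case: (r g y).
rewrite big_distrr /= mulnC -sum_nat_const; apply: leq_sum => g gY.
have := gX g gY; have := card_row X (r g).
by move=> <- /orP[] h; nia.
Qed.

(** Where the two rows agree, one of them deviates from its majority value; this happens on at most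
    2/m <= 1/2 of [X]. *)
Lemma majority_sep (S T : finType) (r : S -> T -> bool) m (Y : {set S})
    (X : {set T}) g h :
  3 < m -> good r m Y X -> 0 < #|X| -> g \in Y -> h \in Y ->
  (g \in majority r Y X) != (h \in majority r Y X) ->
  #|X| <= 2 * #|[set x in X | r g x != r h x]|.
Proof.
move=> m3 gX X0 gY hY gh.
have := good_majority (ltnW m3) gX X0 hY; have := good_majority (ltnW m3) gX X0 gY.
move: (g \in majority r Y X) (h \in majority r Y X) gh => a b ab.
set Eg := [set x in X | _ != a]; set Eh := [set x in X | _ != b].
set D := [set x in X | _] => hg hh.
have : #|X| <= #|Eg| + #|Eh| + #|D|.
  apply: (@leq_trans #|Eg :|: Eh :|: D|); last first.
    by rewrite (leq_trans (leq_card_setU _ _)) // leq_add2r leq_card_setU.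
  apply: subset_leq_card; apply/subsetP=> x xX; rewrite !(in_setU, in_set) xX /=.
  by move: a b ab {Eg Eh hg hh} => [] [] // _; case: (r g x); case: (r h x).
by nia.
Qed.

(** * Stabilisers of majority sets in an abelian group *)

Definition sum_rel (gT : finGroupType) (A : {set gT}) : rel gT :=
  fun g x => (g * x)%g \in A.

Lemma stabP (gT : finGroupType) (G : {group gT}) (B : {set gT}) h :
  reflect (h \in G /\ (B :* h)%g = B) (h \in 'C_G[B | 'Rs]%g).
Proof.
rewrite -rcosetE in_setI; apply: (iffP andP) => -[hG]; first by move/astab1P.
by move=> e; split=> //; apply/astab1P.
Qed.

(** Pairs of [X'] in different cosets of the stabiliser are separated by at least |X|/2 points, so
    [good_pairs] with parameter 8n allows at most |X'|^2/2 of them; yet each [x] has at least |X'| -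
    |H| such partners. *)
Lemma stab_large (gT : finGroupType) (G : {group gT}) (A X X' : {set gT}) m n :
  abelian G -> X \subset G -> X' \subset G -> 3 < m -> 0 < n ->
  0 < #|X| -> 0 < #|X'| -> #|G| <= n * #|X| ->
  good (sum_rel A) m G X -> good (sum_rel A) (8 * n) G X' ->
  #|X'| <= 2 * #|'C_G[majority (sum_rel A) G X | 'Rs]%g|.
Proof.
move=> abG sX sX' m3 n0 X0 X'0 hn gX gX'.
set B := majority _ _ _; set H := ('C_G[B | 'Rs])%G; rewrite -[X in 2 * X]/#|H|.
have sep x y : x \in X' -> y \in X' -> (x^-1 * y)%g \notin H ->
    #|X| <= 2 * #|[set g in G | sum_rel A g x != sum_rel A g y]|.
  move=> /(subsetP sX') xG /(subsetP sX') yG nH.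
  have [g gG gB] : exists2 g, g \in G & ((g * x)%g \in B) != ((g * y)%g \in B).
    apply/exists_inP; apply: contraR nH => /exists_inPn e.
    apply/stabP; split; first by rewrite groupM ?groupV.
    apply/setP=> u; rewrite mem_rcoset invMg invgK.
    case: (boolP (u \in G)) => uG; last first.
      by rewrite !inE (negPf uG) groupMr ?groupM ?groupV // (negPf uG).
    have := e (u * y^-1)%g; rewrite groupM ?groupV // negbK => /(_ isT)/eqP.
    by rewrite mulgKV mulgA.
  apply: leq_trans (majority_sep m3 gX X0 _ _ gB) _; rewrite ?groupM // leq_mul2l /=.
  (* By commutativity, a [z] separating the rows [g * x] and [g * y] makes the columns [x] and [y]
     differ at [g * z]. *)
  rewrite -(card_imset _ (mulgI g)); apply: subset_leq_card.
  apply/subsetP=> _ /imsetP[z + ->]; rewrite inE => /andP[/(subsetP sX) zG hz].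
  rewrite inE groupM //=; move: hz; rewrite /sum_rel -!mulgA.
  by rewrite (centsP abG z zG x xG) (centsP abG z zG y yG).
have := good_pairs gX'; set N := \sum_(x in X') _ => hN.
have : #|X'| * ((#|X'| - #|H|) * #|X|) <= 2 * N.
  rewrite big_distrr /= -sum_nat_const; apply: leq_sum => x xX'.
  have xG := subsetP sX' x xX'.
  rewrite big_distrr /= (bigID (fun y => (x^-1 * y)%g \in H)) /= addnC.
  apply: leq_trans (leq_addr _ _).
  apply: (@leq_trans (\sum_(y in X' | (x^-1 * y)%g \notin H) #|X|)); last first.
    by apply: leq_sum => y /andP[yX' yH]; apply: sep.
  rewrite sum_nat_cond_const leq_mul2r; apply/orP; right.
  have <- := card_row X' (fun y => (x^-1 * y)%g \in H).
  rewrite leq_subLR [X in _ <= X]addnC addnC leq_add2l.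
  rewrite -(card_lcoset H x); apply: subset_leq_card.
  by apply/subsetP=> y; rewrite inE mem_lcoset => /andP[].
move=> hx; clear sep; clearbody N.
move: #|H| #|X'| #|X| #|G| X0 X'0 hN hn hx => h x' x g X0 X'0 hN hn hx.
have : 8 * n * (x' * ((x' - h) * x)) <= 4 * x' ^ 2 * (n * x).
  apply: (@leq_trans (8 * n * (2 * N))); first by rewrite leq_mul2l hx orbT.
  by apply: (@leq_trans (2 * (2 * x' ^ 2 * g))); nia.
have -> : 8 * n * (x' * ((x' - h) * x)) = (4 * n * x' * x) * (2 * (x' - h)) by nia.
have -> : 4 * x' ^ 2 * (n * x) = (4 * n * x' * x) * x' by nia.
by rewrite leq_pmul2l; nia.
Qed.

Lemma stable_good (gT : finGroupType) (G : {group gT}) (A : {set gT}) k m :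
  stable G k A -> 0 < m ->
  exists X : {set gT}, [/\ X \subset G, good (sum_rel A) m G X, 0 < #|X|
    & #|G| <= m ^ order_height k * #|X|].
Proof.
move=> stA m0.
have [t|//] := tree_or_good (sum_rel A) (order_height k) G m0 (cardG_gt0 G).
have [a [b [aG bG ab]]] := tree_order 1%g 1%g t.
case: stA; exists (fun i => a i), (fun j => b j).
by split=> [i|j|i j]; [apply: aG | apply: bG | rewrite -ab].
Qed.

Lemma stable_nat (gT : finGroupType) (G : {group gT}) (A : {set gT}) k m
    (d := order_height k) :
  abelian G -> A \subset G -> stable G k A -> 3 < m ->
  exists (H : {group gT}) (B : {set gT}),
    [/\ H \subset G, B \subset G, forall h, h \in H -> (B :* h)%g = B,
        #|G : H|%g <= 2 * (8 * m ^ d) ^ d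
      & m * #|symdiff A B| <= #|G|].
Proof.
move=> abG sA stA m3; have m0 : 0 < m by apply: leq_trans m3.
have md0 : 0 < m ^ d by rewrite expn_gt0 m0.
have m'0 : 0 < 8 * m ^ d by rewrite muln_gt0.
(* The first set has |G|/|X| <= m^d; this bound is the [n] that sets the precision 8n of the
   second. *)
have [X [sX gX X0 hX]] := stable_good stA m0.
have [X' [sX' gX' X'0 hX']] := stable_good stA m'0.
have [x xX hx] := majority_approx (ltnW m3) gX X0.
have hH := stab_large abG sX sX' m3 md0 X0 X'0 hX gX gX'.
set B := majority _ _ _ in hx hH; set H := ('C_G[B | 'Rs])%G.
have xG := subsetP sX x xX.
have sB : B \subset G by apply: subset_sep.
exists H, (B :* x)%g; split.
- exact: subsetIl.
- by apply/subsetP=> y; rewrite mem_rcoset => /(subsetP sB); rewrite groupMr ?groupV.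
- move=> h /stabP[hG e]; rewrite -[in RHS]e -!rcosetM.
  by rewrite (centsP abG x xG h hG).
- rewrite -(leq_pmul2l (cardG_gt0 H)) Lagrange ?subsetIl //.
  apply: leq_trans hX' _; rewrite -/d mulnC mulnCA.
  by rewrite [X in _ <= X]mulnA leq_mul2r hH orbT.
(* Translation by [x] carries the disagreements of column [x] with the majority onto a set
   containing the symmetric difference. *)
apply: leq_trans hx; rewrite leq_mul2l; apply/orP; right.
rewrite -[X in _ <= X](card_imset _ (mulIg x)); apply: subset_leq_card.
apply/subsetP=> y yAB.
have yG : y \in G.
  move: yAB; rewrite !inE mem_rcoset => /orP[/andP[_ /(subsetP sA)]|/andP[_ /(subsetP sB)]] //.
  by rewrite groupMr ?groupV.
apply/imsetP; exists (y * x^-1)%g; last by rewrite mulgKV.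
move: yAB; rewrite in_set groupM ?groupV // /sum_rel mulgKV /= in_setU !in_setD mem_rcoset.
by case: (y \in A); case: (_ \in B).
Qed.

Lemma invariant_cosets (gT : finGroupType) (G H : {group gT}) (B : {set gT}) :
  H \subset G -> G \subset 'N(H)%g -> B \subset G ->
  (forall h, h \in H -> (B :* h)%g = B) ->
  exists2 J : {set coset_of H}, J \subset (G / H)%g & \bigcup_(X in J) X = B.
Proof.
move=> sH nH sB hB; exists (coset H @: B).
  by apply/subsetP=> _ /imsetP[b bB ->]; apply: mem_quotient; apply: (subsetP sB).
apply/setP=> y; apply/bigcupP/idP => [[_ /imsetP[b bB ->]]|yB]; last first.
  exists (coset H y); first exact: imset_f.
  by rewrite val_coset ?rcoset_refl // (subsetP nH) // (subsetP sB).
have bN : b \in 'N(H)%g by rewrite (subsetP nH) // (subsetP sB).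
(* Normality turns the coset into [b *: H], where right invariance of [B] applies. *)
rewrite val_coset // norm_rlcoset // mem_lcoset => hy.
by rewrite -(hB _ hy) mem_rcoset invMg invgK mulKVg.
Qed.

(** * Passage to real bounds *)

Local Open Scope ring_scope.

(** From t <= e^t one gets t^N <= e^(Nt), and N <= 2^N <= t^N. *)
Lemma expn_le_expR (R : realType) (t : R) (N : nat) :
  2 <= t -> t ^+ N <= expR (t ^+ N.+1).
Proof.
move=> t2; have t0 : 0 < t by apply: lt_le_trans t2.
have tlt : t <= expR t.
  by apply: le_trans (expR_ge1Dx t); rewrite lerDr.
apply: (@le_trans _ _ (expR t ^+ N)).
  by rewrite lerXn2r ?nnegrE ?expR_ge0 // ltW.
rewrite -expRM_natl ler_expR exprSr ler_pM2r //.
apply: (@le_trans _ _ (2 ^+ N)); last by rewrite lerXn2r ?nnegrE // ltW.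
by rewrite -natrX ler_nat ltnW // ltn_expl.
Qed.

Theorem corollary4 (R : realType) (k : nat) (hk : (2 <= k)%N) :
  exists C : R, 0 < C /\
  forall eps : R, 0 < eps -> eps < 1 ->
  exists n5 : nat,
  forall (gT : finGroupType) (G : {group gT}) (A : {set gT}),
    abelian G -> (n5 <= #|G|)%N -> A \subset G -> stable G k A ->
  exists (H : {group gT}) (J : {set coset_of H}),
    [/\ H \subset G,
        (#|G : H|%g)%:R <= expR (eps `^ (- C)),
        J \subset (G / H)%g
      & #|symdiff A (\bigcup_(X in J) X)|%:R <= eps * #|G|%:R].
Proof.
(* With t = 1/eps >= 2, m <= t^4 and 8 <= t^3, the index bound 2(8m^d)^d is at most t(t^3 t^(4d))^d
   = t^N. *)
pose d := order_height k; pose N := ((4 * d + 3) * d).+1.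
exists N.+1%:R; split=> // eps eps0 eps1; exists 0%N => gT G A abG _ sA stA.
set t := eps^-1; have t0 : 0 < t by rewrite invr_gt0.
have -> : eps `^ (- N.+1%:R) = t ^+ N.+1 by rewrite powRN powR_mulrn ?ltW // exprVn.
have [epsh|epsh] := leP 2^-1 eps.
  (* The index bound may be as small as e here, so take H = G. *)
  have [B [sB hB AB]] : exists B : {set gT}, [/\ B \subset G,
      forall h, h \in G -> (B :* h)%g = B & (2 * #|symdiff A B| <= #|G|)%N].
    (* The nearer of [set0] and [G] to [A] errs on at most half of [G]. *)
    have [hA|hA] := leqP (2 * #|A|)%N #|G|.
      exists set0; rewrite sub0set; split=> // [h _|].
        by apply/setP=> y; rewrite mem_rcoset !inE.
      by rewrite /symdiff setD0 set0D setU0.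
    exists G; split=> // [h hG|]; first by rewrite rcoset_id.
    have -> : symdiff A G = G :\: A.
      rewrite /symdiff (_ : A :\: G = set0) ?set0U //.
      by apply/eqP; rewrite setD_eq0.
    move: hA; rewrite -(cardsID A G) (setIidPr sA) !mul2n -!addnn.
    by rewrite ltn_add2l leq_add2r => /ltnW.
  have [J sJ eJ] := invariant_cosets (subxx G) (normG G) sB hB.
  exists G, J; rewrite eJ indexgg; split=> //.
    by apply: le_trans (expR_ge1Dx _); rewrite lerDl exprn_ge0 ?ltW.
  apply: le_trans (ler_wpM2r _ epsh); last exact: ler0n.
  by rewrite ler_pdivlMl // -natrM ler_nat.
have t2 : 2 <= t by rewrite -[2]invrK lef_pV2 ?posrE ?invr_gt0 ?ltW.
(* The successor puts [m] above t, the 3 puts it above 3, and m <= t + 4 <= t^4. *)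
pose m := ((Num.truncn t).+1 + 3)%N.
have tm : t <= m%:R by rewrite (le_trans (ltW (truncnS_gt t))) // ler_nat leq_addr.
have mt : m%:R <= t ^+ 4.
  apply: (@le_trans _ _ (t + 4)).
    by rewrite /m addSnnS natrD lerD2r truncn_le ltW.
  have h := ler_pM (ler0n R 2) (ler0n R 2) t2 t2.
  have := ler_pM (mulr_ge0 (ler0n R 2) (ler0n R 2)) (mulr_ge0 (ler0n R 2) (ler0n R 2)) h h.
  nra.
have m3 : (3 < m)%N by rewrite /m addSn ltnS leq_addl.
have [H [B [sH sB hB iH AB]]] := stable_nat abG sA stA m3.
have nH : G \subset 'N(H)%g by apply: sub_abelian_norm.
have [J sJ eJ] := invariant_cosets sH nH sB hB.
exists H, J; rewrite eJ; split=> //; last first.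
  rewrite -[eps]invrK ler_pdivlMl //; apply: (@le_trans _ _ (m * #|symdiff A B|)%N%:R).
    by rewrite natrM ler_wpM2r // ler0n.
  by rewrite ler_nat.
apply: le_trans (expn_le_expR N t2).
apply: (@le_trans _ _ (2 * (8 * m ^ d) ^ d)%N%:R); first by rewrite ler_nat.
have t0' := ltW t0; have h8 : (8 : R) <= t ^+ 3.
  by have -> : (8 : R) = 2 ^+ 3 by [rewrite -natrX]; rewrite lerXn2r ?nnegrE // ltW.
rewrite natrM natrX natrM natrX exprS ler_pM ?exprn_ge0 ?mulr_ge0 ?exprn_ge0 //.
rewrite exprM.
rewrite lerXn2r ?nnegrE ?mulr_ge0 ?exprn_ge0 //.
rewrite addnC exprD exprM ler_pM ?exprn_ge0 //.
by rewrite lerXn2r ?nnegrE ?exprn_ge0.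
Qed.
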